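(* Let $k\ge 1$, let $a_1,\ldots,a_k$ be nonnegative integers, let $n=a_1+\cdots+a_k$ and let $S\subseteq\{1,\ldots,k\}$. The number of $(a_1,\ldots,a_k,S)$-derangements is equal to $$\frac{1}{a_1!\cdots a_k!}\sum_{\pi\in S_n} c_S(\pi),$$ where $S_n$ is the symmetric group on $\{1,\ldots,n\}$ and $c_S(\pi)$ is the weight defined in the context.
   Context: Partition $\{1,\ldots,n\}$ into consecutive blocks $A_1,\ldots,A_k$ (in this order) with $|A_i|=a_i$, i.e. $A_i=\{a_1+\cdots+a_{i-1}+1,\ldots,a_1+\cdots+a_i\}$. An $(a_1,\ldots,a_k,S)$-permutation is a permutation $\pi$ of $\{1,\ldots,n\}$ that descends within each block $A_i$ with $i\in S$ (that is, $\pi(j)>\pi(j+1)$ whenever $j,j+1\in A_i$) and ascends within each block $A_i$ with $i\notin S$ (that is, $\pi(j)<\pi(j+1)$ whenever $j,j+1\in A_i$); no condition is imposed between different blocks. An $(a_1,\ldots,a_k,S)$-derangement is an $(a_1,\ldots,a_k,S)$-permutation with no fixed points, i.e. no $j$ with $\pi(j)=j$. The block $A_i$ is called descending if $i\in S$ and ascending if $i\notin S$. A cycle of a permutation $\pi\in S_n$ (in its disjoint cycle decomposition, fixed points being cycles of length $1$) is called small if all its elements lie within a single block $A_i$. Define $c_S(\pi)=0$ if $\pi$ has any small cycle of odd length or any small cycle contained in an ascending block; otherwise define $c_S(\pi)=2^m$, where $m$ is the number of small cycles of $\pi$. *)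

(* Defs.v *)
From mathcomp Require Import all_boot all_order all_algebra all_fingroup.

Set Implicit Arguments.
Unset Strict Implicit.
Unset Printing Implicit Defensive.

(* Positions, values and block indices are numbered from 0: {1, ..., n} is
   'I_n and {1, ..., k} is 'I_k. *)

Section BlockPermutations.

Variables (k : nat) (a : 'I_k -> nat) (S : {set 'I_k}).

Definition block_total : nat := \sum_(i < k) a i.

Definition block (i : 'I_k) : {set 'I_block_total} :=
  [set j : 'I_block_total |
    (\sum_(l < k | l < i) a l <= j) && (j < \sum_(l < k | l <= i) a l)].

Definition is_block_perm (s : 'S_block_total) : bool :=
  [forall i : 'I_k, forall j in block i, forall j' in block i,
    (j' == j.+1 :> nat) ==> (if i \in S then s j' < s j else s j < s j')].

Definition is_block_derangement (s : 'S_block_total) : bool :=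
  is_block_perm s && [forall j, s j != j].

(* The members of [porbits s] are the supports of the cycles of s, fixed points
   included as singletons. *)
Definition small_cycles (s : 'S_block_total) : {set {set 'I_block_total}} :=
  [set C in porbits s | [exists i : 'I_k, C \subset block i]].

Definition cS (s : 'S_block_total) : nat :=
  if [exists C in small_cycles s,
        odd #|C| || [exists i : 'I_k, (i \notin S) && (C \subset block i)]]
  then 0 else 2 ^ #|small_cycles s|.

End BlockPermutations.

(* Main.v *)
Require Import Defs.
From mathcomp Require Import all_boot all_order all_algebra all_fingroup.
From mathcomp Require Import zify ring.
Import GRing.Theory.
Local Open Scope ring_scope.

Set Implicit Arguments.
Unset Strict Implicit.
Unset Printing Implicit Defensive.

(** Let P be a set of blocks, and compare two quantities: N_P, the number of
    block permutations whose fixed points all avoid the blocks of P, multiplied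
    by the product of the (a_i)!; and Z_P, the sum over all permutations of the
    product over the cycles C of the weight
      1 - sum of e_i(C) over the i in P such that C lies in the block i,
    where e_i(C) is 1 for an ascending block and -(-1)^|C| for a descending one.
    A cycle C lying in a block of P thus has weight 0 if the block is ascending
    and 1 + (-1)^|C|, that is 0 or 2, if it is descending, so that when P
    contains every block the summand of Z_P is c_S.  When P is empty both
    quantities are n! ([nb_sorted], [cycle_sum_free]).  It remains to see that
    they obey the same recursion in P.

    For N_P, delete a fixed point of a block i outside P.  The other fixed
    points survive.  In an ascending block the differences s(x) - x are
    nondecreasing, so the fixed points form an interval; deleting any of them
    gives the same smaller permutation, and every smaller permutation is
    obtained from exactly one larger one.  In a descending block s(x) - x is
    strictly decreasing, so that the deleted point was the only fixed point of
    the block; a fixed point can be inserted exactly when there is none, and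
    then in one way.  With Q = P in the ascending case and Q = P + i in the
    descending one, the number of block permutations therefore satisfies
      number for P = number for P + i + number for Q with a_i decreased by 1
    ([nb_fixfree_step]).

    For Z_P, adding i to P lowers the weight of the cycles C inside block i by 1
    in the ascending case and raises it by (-1)^|C| in the descending one, so
    that one of the two weights is the other minus u^|C|, with u = 1 or u = -1.
    Expanding the product over cycles marks some of the cycles inside the block;
    let B be their union.  When B contains two points x and y, composing with
    the transposition of x and y changes the parity of the number of cycles
    inside B and leaves the cycles outside B alone, so the terms cancel.  Only B
    empty and B a single fixed point m remain ([cycle_sum_marking]), which gives
      Z_P = Z_(P + i) + sum over the m of block i of Z_Q with m removed
    ([cycle_sum_step]).  The a_i choices of m correspond to the factor a_i by
    which the product of the (a_i)! changes when a_i decreases by 1. *)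

(** * Sums over permutations of products of cycle weights *)

Section Cycles.

Variable T : finType.
Implicit Types (s : {perm T}) (A B C X : {set T}) (x y : T).

Definition stable s B := [forall x in B, s x \in B].

Lemma stableP s B : reflect {in B, forall x, s x \in B} (stable s B).
Proof. exact: forall_inP. Qed.

Lemma stable_expg s B n x : stable s B -> x \in B -> (s ^+ n)%g x \in B.
Proof.
move=> /stableP sB xB; elim: n => [|n IHn]; first by rewrite expg0 perm1.
by rewrite expgSr permM sB.
Qed.

Lemma stable_porbit s B x : stable s B -> (porbit s x \subset B) = (x \in B).
Proof.
move=> sB; apply/idP/idP => [/subsetP-> //|xB]; first exact: porbit_id.
by apply/subsetP => y /porbitP[n ->]; apply: stable_expg.
Qed.

Lemma porbits_porbit s C x : C \in porbits s -> x \in C -> C = porbit s x.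
Proof.
by case/imsetP=> y _ -> xC; apply/esym/eqP; rewrite eq_porbit_mem.
Qed.

Lemma mem_porbits s x : porbit s x \in porbits s.
Proof. exact: imset_f. Qed.

Lemma porbits_ex s C : C \in porbits s -> exists x, C = porbit s x.
Proof. by case/imsetP=> x _ ->; exists x. Qed.

Lemma stable_tpermM s B x y :
  stable s B -> x \in B -> y \in B -> stable (tperm x y * s)%g B.
Proof.
move=> sB xB yB; apply/stableP => z zB; rewrite permM (stableP _ _ sB) //.
by case: tpermP => // ->.
Qed.

Lemma porbits_partition s B :
  stable s B -> partition [set C in porbits s | C \subset B] B.
Proof.
move=> sB; apply/and3P; split.
- apply/eqP/setP => x; apply/bigcupP/idP.
    by case=> C; rewrite inE => /andP[_ /subsetP]; apply.
  by exists (porbit s x); rewrite ?inE ?mem_porbits ?stable_porbit ?porbit_id.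
- apply/trivIsetP => C D; rewrite !inE => /andP[Cs _] /andP[Ds _] CD.
  apply/pred0P => x /=; apply: contraNF CD => /andP[xC xD].
  by rewrite (porbits_porbit Cs xC) (porbits_porbit Ds xD).
- rewrite inE; apply/negP => /andP[/porbits_ex[x /setP/(_ x)]].
  by rewrite porbit_id inE.
Qed.

Section Marking.

Variable R : comNzRingType.
Implicit Types (w t : {set T} -> R).

(** The cycles contained in X are those of the permutation induced on X; the
    points outside X are fixed and contribute no factor.  Keeping T fixed and
    shrinking X avoids a change of type when a point is removed. *)
Definition cycle_sum w X : R :=
  \sum_(s | perm_on X s) \prod_(C in porbits s | C \subset X) w C.

(** Expanding the product chooses a set of cycles; a set of cycles of s is the
    same thing as its union, and the unions of cycles are the stable sets. *)
Lemma prod_porbitsD w t s X : perm_on X s ->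
  \prod_(C in porbits s | C \subset X) (t C + w C) =
  \sum_(B | stable s B && (B \subset X))
    \prod_(C in porbits s | C \subset X) (if C \subset B then t C else w C).
Proof.
move=> sX; set Q := [set C in porbits s | C \subset X].
have inQ C : (C \in porbits s) && (C \subset X) = (C \in Q) by rewrite inE.
have cov B : stable s B -> B \subset X -> cover [set C in Q | C \subset B] = B.
  move=> sB BX; rewrite -[RHS](cover_partition (porbits_partition sB)).
  congr cover; apply/setP => C; rewrite !inE.
  by case CB: (C \subset B); rewrite ?andbF // (subset_trans CB BX) andbT.
rewrite (eq_bigl _ _ inQ) big_mkcond /=.
transitivity (\prod_C ((if C \in Q then t C else 0) +
                       (if C \in Q then w C else 1))).
  by apply: eq_bigr => C _; case: ifP => // _; rewrite add0r.
rewrite bigA_distr /=.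
rewrite (bigID (fun J : {set {set T}} => J \subset Q)) /=.
rewrite [X in _ + X]big1 ?addr0; last first.
  by move=> J /subsetPn[C CJ CQ]; rewrite (bigD1 C) //= CJ (negPf CQ) mul0r.
rewrite (reindex_onto (fun B => [set C in Q | C \subset B]) cover) /=; last first.
  move=> J JQ; apply/setP => C; rewrite inE; apply/andP/idP => [[]|CJ]; last first.
    by rewrite (subsetP JQ) //; split => //; apply: (bigcup_sup C).
  rewrite inE => /andP[Cs _] /subsetP CJ; have [x Cx] := porbits_ex Cs.
  have xC : x \in C by rewrite Cx porbit_id.
  have /bigcupP[D DJ xD] := CJ x xC.
  rewrite (porbits_porbit Cs xC) -(porbits_porbit _ xD) //.
  by have := subsetP JQ D DJ; rewrite inE => /andP[].
apply: eq_big => [B|B _]; last first.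
  rewrite [RHS](eq_bigl _ _ inQ) [RHS]big_mkcond /=; apply: eq_bigr => C _.
  by rewrite [C \in [set _ in Q | _]]inE; case: (C \in Q).
rewrite (_ : _ \subset Q); last by apply/subsetP => C; rewrite inE => /andP[].
apply/eqP/andP => [<-|[]]; last exact: cov.
split.
  apply/stableP => x /bigcupP[C]; rewrite !inE => /andP[/andP[Cs CX] CB] xC.
  apply/bigcupP; exists C; first by rewrite !inE Cs CX.
  by rewrite (porbits_porbit Cs xC) (mem_porbit s 1).
by apply/bigcupsP => C; rewrite !inE => /andP[/andP[_ CX] _].
Qed.

(** A point outside the stable set B never enters B under iteration, so it never
    meets the transposition. *)
Lemma porbits_outside_tperm s B x y : stable s B -> x \in B -> y \in B ->
  forall C, ~~ (C \subset B) ->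
  (C \in porbits (tperm x y * s)%g) = (C \in porbits s).
Proof.
move=> sB xB yB; have: forall s, stable s B -> forall C, ~~ (C \subset B) ->
    C \in porbits (tperm x y * s)%g -> C \in porbits s.
  move=> {}s {}sB C CB /porbits_ex[z Cz].
  have tsB := stable_tpermM sB xB yB.
  have zB : z \notin B by move: CB; rewrite Cz stable_porbit.
  have snB n : (s ^+ n)%g z \notin B.
    by rewrite -(stable_porbit _ sB) porbit_perm stable_porbit.
  suff e n : ((tperm x y * s) ^+ n)%g z = (s ^+ n)%g z.
    rewrite Cz (_ : porbit _ z = porbit s z) ?mem_porbits //.
    by apply/setP => v; apply/porbitP/porbitP => -[n ->]; exists n; rewrite e.
  elim: n => // n IHn; rewrite !expgSr !permM IHn tpermD //.
    by apply: contraNneq (snB n) => <-.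
  by apply: contraNneq (snB n) => <-.
move=> H C CB; apply/idP/idP; first exact: H.
move=> Cs; apply: H (stable_tpermM sB xB yB) _ CB _.
by rewrite mulgA tperm2 mul1g.
Qed.

Definition marked_sum w u B X : R :=
  \sum_(s | perm_on X s && stable s B)
    \prod_(C in porbits s | C \subset X) (if C \subset B then - u ^+ #|C| else w C).

(** The marked factor depends on s only through the parity of the number of
    cycles inside B, which is what makes the sign-reversing argument work. *)
Lemma marked_weightE w u B X s : perm_on X s -> stable s B -> B \subset X ->
  \prod_(C in porbits s | C \subset X) (if C \subset B then - u ^+ #|C| else w C)
  = (-1) ^+ #|[set C in porbits s | C \subset B]| * u ^+ #|B| *
    \prod_(C in porbits s | (C \subset X) && ~~ (C \subset B)) w C.
Proof.
move=> sX sB BX.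
rewrite (bigID (fun C : {set T} => C \subset B)) /=; congr (_ * _); last first.
  rewrite (eq_bigl (fun C => (C \in porbits s) && ((C \subset X) && ~~ (C \subset B)))).
    by apply: eq_bigr => C /and3P[_ _ /negPf->].
  by move=> C; rewrite andbA.
rewrite (card_partition (porbits_partition sB)) -prodrXr -prodr_const -big_split.
apply: eq_big => [C|C]; rewrite ?inE.
  by case CB: (C \subset B); rewrite ?andbF // (subset_trans CB BX) !andbT.
by case/andP=> _ ->; rewrite /= mulN1r.
Qed.

Lemma odd_porbits_inside_tperm s B x y :
  stable s B -> x \in B -> y \in B -> x != y ->
  odd #|[set C in porbits (tperm x y * s)%g | C \subset B]| =
  ~~ odd #|[set C in porbits s | C \subset B]|.
Proof.
move=> sB xB yB nxy.
pose inB := [set C : {set T} | C \subset B].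
have split r : odd #|porbits r| =
    odd #|[set C in porbits r | C \subset B]| (+) odd #|porbits r :\: inB|.
  by rewrite -(cardsID inB) oddD; congr (odd #|pred_of_set _| (+) _);
     apply/setP=> C; rewrite !inE.
have out : porbits (tperm x y * s)%g :\: inB = porbits s :\: inB.
  apply/setP => C; rewrite !inE; case CB: (C \subset B) => //=.
  by rewrite (porbits_outside_tperm sB) ?CB.
have := congr1 odd (porbits_mul_tperm s x y); rewrite nxy !oddD odd_double.
rewrite addbF addbT !split out; by do 3!case: odd.
Qed.

(** Composing with the transposition of two points of B is a sign-reversing
    involution of the index set. *)
Lemma marked_sum_gt1 w u B X : B \subset X -> (1 < #|B|)%N -> marked_sum w u B X = 0.
Proof.
move=> BX /card_gt1P[x [y [xB yB nxy]]].
pose t := tperm x y.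
pose F s :=
  \prod_(C in porbits s | C \subset X) (if C \subset B then - u ^+ #|C| else w C).
pose P s := perm_on X s && stable s B.
rewrite [LHS](_ : _ = \sum_(s | P s) F s) //.
have Pt s : P (t * s)%g = P s.
  have: forall s, P s -> P (t * s)%g.
    move=> {}s /andP[sX sB]; apply/andP; split.
      apply: perm_onM sX; apply: subset_trans (tperm_on x y) _.
      by apply/subsetP => z; rewrite !inE => /orP[]/eqP->; apply: (subsetP BX).
    exact: stable_tpermM.
  move=> H; apply/idP/idP; last exact: H.
  by move/H; rewrite mulgA tperm2 mul1g.
have Ft s : P s -> F (t * s)%g = - F s.
  move=> Ps; have := Ps; rewrite -Pt => /andP[tsX tsB]; have /andP[sX sB] := Ps.
  rewrite /F !marked_weightE // -!mulNr.
  rewrite (eq_bigl (fun C => (C \in porbits s) && ((C \subset X) && ~~ (C \subset B)))).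
    congr (_ * _ * _); rewrite -signr_odd -[in RHS]signr_odd -signrN.
    by rewrite (odd_porbits_inside_tperm sB).
  move=> C; case CB: (C \subset B); rewrite ?andbF // !andbT.
  by rewrite (porbits_outside_tperm sB) ?CB.
(* the involution exchanges even and odd permutations, which gives the
   cancellation even in characteristic 2 *)
rewrite (bigID (@odd_perm T)) /=.
rewrite (reindex_inj (mulgI t)) /=.
rewrite (eq_big (fun s => P s && ~~ s) (fun s => - F s)).
- by rewrite sumrN addNr.
- by move=> s; rewrite Pt odd_mul_tperm nxy.
- by move=> s /andP[]; rewrite Pt => /Ft.
Qed.

Lemma marked_sum0 w u X : marked_sum w u set0 X = cycle_sum w X.
Proof.
apply: eq_big => [s|s _]; first by rewrite andbC; case: stableP => // -[] x; rewrite inE.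
apply: eq_bigr => C /andP[/porbits_ex[x ->] _].
by case: ifP => // /subsetP/(_ x); rewrite porbit_id inE => /(_ isT).
Qed.

Lemma marked_sum1 w u m X : m \in X ->
  marked_sum w u [set m] X = - u * cycle_sum w (X :\ m).
Proof.
move=> mX; rewrite /cycle_sum big_distrr /=.
apply: eq_big => [s|s /andP[sX sm]]; last first.
  have smm : porbit s m = [set m].
    by apply/eqP; rewrite eqEsubset stable_porbit // set11 sub1set porbit_id.
  have ms : [set m] \in porbits s by rewrite -smm mem_porbits.
  rewrite (bigD1 [set m]) /=; last by rewrite ms sub1set.
  rewrite subxx cards1 expr1; congr (_ * _).
  apply: eq_big => [C|C /andP[/andP[Cs CX] nCm]]; last first.
    by rewrite subset1 (negPf nCm); case/porbits_ex: Cs => x ->;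
       case: eqP => // /setP/(_ x); rewrite porbit_id inE.
  rewrite subsetD1 -andbA; case Cs: (C \in _) => //=; case: (C \subset X) => //=.
  congr negb; apply/eqP/idP => [->|/(porbits_porbit Cs)]; last by rewrite smm.
  exact: set11.
apply/andP/idP => [[/subsetP sX /stableP/(_ m (set11 _))]|/subsetP sX].
  rewrite inE => /eqP sm; apply/subsetP => x; rewrite !inE => sx.
  by rewrite (sX x sx) andbT; apply: contraNneq sx => ->; rewrite sm.
split; first by apply/subsetP => x /sX; rewrite inE => /andP[].
apply/stableP => x; rewrite !inE => /eqP->; apply/negPn/negP => sm.
by have := sX m sm; rewrite !inE eqxx.
Qed.

(** The exponential generating function behind this identity: the cycles on A
    with weight - u^|C| contribute exp (log (1 - u x)) = 1 - u x, whose two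
    terms correspond to no marked point and to one marked fixed point. *)
Lemma cycle_sum_marking w u A X :
  cycle_sum (fun C => w C - (if C \subset A then u ^+ #|C| else 0)) X =
  cycle_sum w X - u * \sum_(m in A :&: X) cycle_sum w (X :\ m).
Proof.
pose t C : R := if C \subset A then - u ^+ #|C| else 0.
transitivity (\sum_(s | perm_on X s) \sum_(B | stable s B && (B \subset X))
    \prod_(C in porbits s | C \subset X) (if C \subset B then t C else w C)).
  apply: eq_bigr => s sX; rewrite -prod_porbitsD //; apply: eq_bigr => C _.
  by rewrite addrC /t; case: ifP => //; rewrite oppr0.
rewrite (exchange_big_dep (fun B => B \subset X)) /=; last by move=> ? ? _ /andP[].
transitivity (\sum_(B : {set T} | B \subset A :&: X) marked_sum w u B X).
  rewrite big_mkcond [RHS]big_mkcond /=; apply: eq_bigr => B _.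
  rewrite subsetI; case BX: (B \subset X); rewrite ?andbF // andbT.
  case: ifPn => [BA|/subsetPn[x xB xA]].
    apply: eq_big => [s|s _]; first by rewrite andbT.
    apply: eq_bigr => C _; case: ifP => // CB.
    by rewrite /t (subset_trans CB BA).
  (* a point of B outside A lies on a marked cycle of weight 0 *)
  apply: big1 => s /andP[sX]; rewrite andbT => sB.
  have sBx : porbit s x \subset B by rewrite stable_porbit.
  rewrite (bigD1 (porbit s x)) /=; last by rewrite mem_porbits (subset_trans sBx).
  rewrite sBx /t.
  case: ifP => [/subsetP/(_ x)|]; last by rewrite mul0r.
  by rewrite porbit_id (negPf xA) => /(_ isT).
rewrite (bigD1 set0) ?sub0set //= marked_sum0; congr (_ + _).
rewrite (bigID (fun B : {set T} => #|B| == 1)) /= [X in _ + X]big1 ?addr0; last first.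
  move=> B /andP[/andP[BAX B0] B1]; apply: marked_sum_gt1.
    by apply: subset_trans BAX (subsetIr _ _).
  by rewrite ltn_neqAle eq_sym B1 card_gt0.
rewrite -mulNr big_distrr /=.
rewrite (eq_bigl (fun B => B \in [set [set m] | m in A :&: X])); last first.
  move=> B; apply/andP/imsetP => [[/andP[BAX _] /cards1P[m Bm]]|[m mAX ->]].
    by exists m => //; rewrite -sub1set -Bm.
  by rewrite sub1set mAX cards1 -card_gt0 cards1.
rewrite big_imset /=; last by move=> x y _ _; apply: set1_inj.
by apply: eq_bigr => m /setIP[_ mX]; apply: marked_sum1.
Qed.

End Marking.

End Cycles.

(** * Inserting a point into a permutation *)

Section Lift.
Local Open Scope nat_scope.

Lemma ltn_lift n (j : 'I_n.+1) (x y : 'I_n) : (lift j x < lift j y) = (x < y).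
Proof. by rewrite /= /bump; case: leqP; case: leqP; lia. Qed.

Lemma lift_ltE n (j : 'I_n.+1) (x : 'I_n) : x < j -> lift j x = x :> nat.
Proof. by rewrite /= /bump; lia. Qed.

Lemma lift_geE n (j : 'I_n.+1) (x : 'I_n) : j <= x -> lift j x = x.+1 :> nat.
Proof. by rewrite /= /bump; lia. Qed.

Lemma lift_ltn n (j : 'I_n.+1) (x : 'I_n) : (lift j x < j) = (x < j).
Proof. by rewrite /= /bump; case: leqP; lia. Qed.

Lemma ltn_lift_r n (j : 'I_n.+1) (x : 'I_n) : (j < lift j x) = (j <= x).
Proof. by rewrite /= /bump; case: leqP; lia. Qed.

Lemma lift_perm_surj n (s : 'S_n.+1) j : exists r, s = lift_perm j (s j) r.
Proof.
pose f x := odflt x (unlift (s j) (s (lift j x))).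
have fE x : lift (s j) (f x) = s (lift j x).
  rewrite /f; case: unliftP => [y ->//|/perm_inj/eqP].
  by rewrite eq_sym (negPf (neq_lift _ _)).
have f_inj : injective f.
  by move=> x y fxy; apply: (@lift_inj _ j); apply: (@perm_inj _ s); rewrite -!fE fxy.
exists (perm f_inj); apply/permP => x.
case: (unliftP j x) => [y|] ->; first by rewrite lift_perm_lift permE fE.
by rewrite lift_perm_id.
Qed.

Lemma lift_perm_inj n (j k : 'I_n.+1) : injective (lift_perm j k).
Proof.
move=> r t e; apply/permP => x; apply: (@lift_inj _ k).
by rewrite -!(lift_perm_lift j) e.
Qed.

Lemma sum_lift_perm n (j k : 'I_n.+1) (F : 'S_n.+1 -> nat) :
  \sum_(s : 'S_n.+1 | s j == k) F s = \sum_(r : 'S_n) F (lift_perm j k r).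
Proof.
rewrite [RHS](eq_bigl (fun r => r \in [set: 'S_n])); last by move=> r; rewrite inE.
rewrite -(big_imset (h := lift_perm j k) F) /=; last by move=> r t _ _ /lift_perm_inj.
apply: eq_bigl => s; apply/eqP/imsetP => [<-|[r _ ->]]; last exact: lift_perm_id.
by have [r e] := lift_perm_surj s j; exists r; rewrite ?inE.
Qed.

End Lift.

(** * Sorted permutations and their fixed points *)

Section Blocks.
Local Open Scope nat_scope.
Variables (I : finType) (S : {set I}).
Implicit Types (P : {set I}) (i l : I).

(** Blocks are encoded as the classes of a coloring of the positions: deleting a
    position is then a composition with [lift], and no block size enters a
    type. *)
Definition interval_coloring n (c : 'I_n -> I) :=
  forall x y z : 'I_n, x <= y -> y <= z -> c x = c z -> c y = c x.

Definition sorted_perm n (c : 'I_n -> I) (s : 'S_n) :=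
  [forall x : 'I_n, forall y : 'I_n, (x < y) && (c x == c y) ==>
     (if c x \in S then s y < s x else s x < s y)].

Definition fixfree P n (c : 'I_n -> I) (s : 'S_n) :=
  [forall x, (c x \in P) ==> (s x != x)].

Definition nb_fixfree P n (c : 'I_n -> I) :=
  #|[set s | sorted_perm c s && fixfree P c s]|.

Definition class_size (T : finType) (X : {set T}) (c : T -> I) l :=
  #|[set x in X | c x == l]|.

Definition class_fact n (c : 'I_n -> I) := \prod_l (class_size setT c l)`!.

Lemma sorted_permP n (c : 'I_n -> I) (s : 'S_n) :
  reflect (forall x y : 'I_n, x < y -> c x = c y ->
             if c x \in S then s y < s x else s x < s y) (sorted_perm c s).
Proof.
apply: (iffP 'forall_forallP) => [H x y xy cxy|H x y].
  by have := H x y; rewrite xy cxy eqxx.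
by apply/implyP => /andP[xy /eqP]; apply: H.
Qed.

Lemma fixfreeP P n (c : 'I_n -> I) (s : 'S_n) :
  reflect (forall x, c x \in P -> s x != x) (fixfree P c s).
Proof. exact: forall_inP. Qed.

Lemma class_size_lift n (c : 'I_n.+1 -> I) m l :
  class_size setT c l = (c m == l) + class_size setT (fun x => c (lift m x)) l.
Proof.
rewrite /class_size -!sum1dep_card big_mkcond (bigD1_ord m) //=.
rewrite inE [in RHS]big_mkcond /=; congr (_ + _).
by apply: eq_bigr => x _; rewrite !inE.
Qed.

Lemma class_fact_lift n (c : 'I_n.+1 -> I) m :
  class_fact c = class_size setT c (c m) * class_fact (fun x => c (lift m x)).
Proof.
rewrite /class_fact (bigD1 (c m)) //= [in RHS](bigD1 (c m)) //= mulnA.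
congr (_ * _); first by rewrite (class_size_lift c m) eqxx add1n factS.
by apply: eq_bigr => l lm; rewrite (class_size_lift c m) eq_sym (negPf lm).
Qed.

(** The end of a block at which the largest value of a sorted permutation may
    occur: its last position if ascending, its first one if descending. *)
Definition block_top n (c : 'I_n -> I) j :=
  [forall x : 'I_n, (c x == c j) ==> (if c j \in S then j <= x else x <= j)].

Lemma sorted_lift_max n (c : 'I_n.+1 -> I) j (r : 'S_n) :
  sorted_perm c (lift_perm j ord_max r) =
  block_top c j && sorted_perm (fun x => c (lift j x)) r.
Proof.
apply/sorted_permP/andP => [H|[/forall_inP top /sorted_permP H] x y].
  split.
    apply/forall_inP => x /eqP cx; case: (ltngtP x j) => // xj; last by case: ifP.
      have := H x j xj cx; rewrite lift_perm_id cx; case: ifP => _ //=.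
      by rewrite ltnNge -ltnS ltn_ord.
    have := H j x xj (esym cx); rewrite lift_perm_id; case: ifP => _ //=.
    by rewrite ltnNge -ltnS ltn_ord.
  apply/sorted_permP => x y xy cxy.
  have := H (lift j x) (lift j y); rewrite ltn_lift !lift_perm_lift.
  by move/(_ xy cxy); rewrite !ltn_lift.
case: (unliftP j x) => [x'|] ->; case: (unliftP j y) => [y'|] ->.
- by rewrite !lift_perm_lift !ltn_lift; apply: H.
- move=> xj cx; rewrite lift_perm_id lift_perm_lift cx.
  have := top (lift j x'); rewrite cx eqxx => /(_ isT).
  by case: ifP => _; [lia|rewrite lift_max].
- move=> xj cx; rewrite lift_perm_id lift_perm_lift.
  have := top (lift j y'); rewrite cx eqxx => /(_ isT).
  by case: ifP => _; [rewrite lift_max|lia].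
by rewrite ltnn.
Qed.

(** Each nonempty block has exactly one top, counted with the block size. *)
Lemma sum_block_top n (c : 'I_n -> I) :
  \sum_(j | block_top c j) class_size setT c (c j) = n.
Proof.
rewrite -[RHS]card_ord -sum1_card.
transitivity (\sum_(x < n) \sum_(j < n | block_top c j && (c x == c j)) 1).
  rewrite (exchange_big_dep (block_top c)) /=; last by move=> ? ? _ /andP[].
  apply: eq_bigr => j topj; rewrite /class_size -sum1dep_card.
  by apply: eq_bigl => x; rewrite inE topj.
apply: eq_bigr => x _.
have [j cj topj] : exists2 j, c j = c x & block_top c j.
  case xS: (c x \in S).
    case: (@arg_minnP _ x (fun j => c j == c x) (fun j => j : nat)) => // j /eqP cj H.
    by exists j => //; apply/forall_inP => y; rewrite cj xS; apply: H.
  case: (@arg_maxnP _ x (fun j => c j == c x) (fun j => j : nat)) => // j /eqP cj H.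
  by exists j => //; apply/forall_inP => y; rewrite cj xS; apply: H.
rewrite (big_pred1 j) // => k /=.
apply/andP/eqP => [[topk /eqP ck]|->]; last by rewrite cj.
have := forall_inP topj k; have := forall_inP topk j.
rewrite -ck cj eqxx => /(_ isT) + /(_ isT); case: ifP => _ a b;
by apply/val_inj => /=; lia.
Qed.

(** Deleting the largest value gives
      number for c = sum over the tops j of the number for c without j,
    and multiplying by the factorials turns the summand for j into the size of
    the block of j times (n - 1)!; these sizes add up to n. *)
Lemma nb_sorted n (c : 'I_n -> I) : nb_fixfree set0 c * class_fact c = n`!.
Proof.
have nbE m (d : 'I_m -> I) : nb_fixfree set0 d = \sum_(s : 'S_m) sorted_perm d s.
  rewrite /nb_fixfree -sum1dep_card big_mkcond /=; apply: eq_bigr => s _.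
  rewrite (_ : fixfree _ _ _); first by rewrite andbT; case: sorted_perm.
  by apply/fixfreeP => x; rewrite inE.
elim: n c => [|n IHn] c.
  rewrite nbE /class_fact [X in _ * X]big1; last first.
    by move=> l _; rewrite /class_size (_ : [set _ in _ | _] = set0) ?cards0 //;
       apply/setP => -[].
  rewrite (eq_bigr (fun=> 1)) ?sum1_card; first by rewrite card_Sn.
  by move=> s _; rewrite (_ : sorted_perm c s) //; apply/sorted_permP => -[].
rewrite nbE (partition_big (fun s : 'S_n.+1 => s^-1%g ord_max) xpredT) //=.
rewrite big_distrl /= factS -[X in X * _](sum_block_top c) big_distrl [RHS]big_mkcond /=.
apply: eq_bigr => j _.
rewrite (eq_bigl (fun s : 'S_n.+1 => s j == ord_max)); last first.
  by move=> s; apply/eqP/eqP => [<-|<-]; rewrite ?permKV ?permK.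
rewrite sum_lift_perm (eq_bigr (fun r => block_top c j * sorted_perm (fun x => c (lift j x)) r));
  last by move=> r _; rewrite sorted_lift_max mulnb.
rewrite -big_distrr -nbE /=; case: ifP => _; rewrite ?mul1n //.
by rewrite (class_fact_lift c j) mulnCA IHn.
Qed.

(** A step to the next position of a block changes the value by at least 1, so
    s(x) - x is nondecreasing on an ascending block and s(x) + x is
    nonincreasing on a descending one. *)
Lemma sorted_drift n (c : 'I_n -> I) (s : 'S_n) (x y : 'I_n) : interval_coloring c ->
  sorted_perm c s -> x <= y -> c x = c y ->
  if c x \in S then s y + y <= s x + x else s x + y <= s y + x.
Proof.
move=> cI /sorted_permP cs; case: y => y; elim: y => [|y IHy] yn /=.
  rewrite leqn0 => /eqP x0 _; rewrite (_ : Ordinal yn = x) ?x0; last exact: val_inj.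
  by case: ifP.
rewrite leq_eqVlt => /predU1P[xy _|xy cxy].
  by rewrite (_ : Ordinal yn = x) ?xy; [case: ifP|apply: val_inj].
pose z : 'I_n := Ordinal (ltnW yn).
have czx : c z = c x by apply: cI cxy => //=; lia.
have := IHy (ltnW yn) xy (esym czx).
have := cs z (Ordinal yn) (ltnSn y); rewrite czx -cxy => /(_ erefl).
by rewrite -/z; case: ifP => _ /=; lia.
Qed.

Lemma interval_coloring_lift n (c : 'I_n.+1 -> I) m :
  interval_coloring c -> interval_coloring (fun x => c (lift m x)).
Proof.
by move=> cI x y z xy yz; apply: cI; rewrite leqNgt ltn_lift -leqNgt.
Qed.

(** Deleting either of two positions of the same block leaves the same coloring,
    since every position between them has their color. *)
Lemma lift_same_color n (c : 'I_n.+1 -> I) j k (x : 'I_n) :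
  interval_coloring c -> c j = c k -> c (lift j x) = c (lift k x).
Proof.
move=> cI; wlog jk : j k / j <= k => [H cjk|cjk].
  by case/orP: (leq_total j k) => ?; [apply: H | apply/esym/H].
case: (ltnP x j) => xj.
  by congr c; apply: val_inj; rewrite /= /bump; lia.
case: (ltnP x k) => xk; last by congr c; apply: val_inj; rewrite /= /bump; lia.
have jx := lift_geE xj; have kx := lift_ltE xk.
by rewrite (cI j (lift j x) k) ?(cI j (lift k x) k) // ?jx ?kx //; lia.
Qed.

(** Choosing the first fixed point of the block makes the deletion canonical. *)
Definition first_fix n (c : 'I_n -> I) i (s : 'S_n) j :=
  [&& c j == i, s j == j &
      [forall x : 'I_n, (c x == i) && (s x == x) ==> (j <= x)]].

(** The insertion slots for which the new fixed point is the first one of its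
    block: the points before the slot must be moved down (ascending block) or up
    (descending block), and no others. *)
Definition fix_slot n (c : 'I_n -> I) i (r : 'S_n) (j : 'I_n.+1) :=
  [forall x : 'I_n, (c x == i) ==>
     ((x < j) == (if i \in S then x < r x else r x < x))].

Section Deletion.

Variables (n : nat) (c' : 'I_n.+1 -> I) (c : 'I_n -> I) (i : I).
Hypothesis c'I : interval_coloring c'.
Hypothesis cE : forall j, c' j = i -> forall x, c' (lift j x) = c x.

Lemma sorted_lift j r : c' j = i -> sorted_perm c' (lift_perm j j r) -> sorted_perm c r.
Proof.
move=> cj /sorted_permP H; apply/sorted_permP => x y xy cxy.
have := H (lift j x) (lift j y); rewrite ltn_lift !lift_perm_lift !cE //.
by move/(_ xy cxy); rewrite !ltn_lift.
Qed.

Lemma fixfree_lift P j r : i \notin P -> c' j = i ->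
  fixfree P c' (lift_perm j j r) = fixfree P c r.
Proof.
move=> iP cj; apply/fixfreeP/fixfreeP => H x.
  by rewrite -(cE cj) => /H; rewrite lift_perm_lift; apply: contraNN => /eqP->.
case: (unliftP j x) => [y|] ->; last by rewrite cj (negPf iP).
by rewrite (cE cj) lift_perm_lift => /H; apply: contraNN => /eqP/lift_inj->.
Qed.

(** Before the first fixed point j of an ascending block the differences
    s(x) - x are negative, and after it they are nonnegative, so that they remain
    so when the value j is deleted.  In a descending block the positions before j
    have values above j, and those after j have values below j. *)
Lemma sorted_first_fix_slot j r : c' j = i ->
  sorted_perm c' (lift_perm j j r) -> first_fix c' i (lift_perm j j r) j ->
  ((i \in S) ==> fixfree [set i] c r) && fix_slot c i r j.
Proof.
move=> cj cs /and3P[_ _ /forall_inP first].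
have H x : c x = i ->
    ((x < j) = (if i \in S then x < r x else r x < x)) /\ (i \in S -> r x != x).
  move=> cx; have c'x : c' (lift j x) = i by rewrite cE.
  have sx := lift_perm_lift j j r x; have sj := lift_perm_id j j r.
  case: (ltnP x j) => xj.
    have lx := lift_ltE xj.
    have lxj : lift j x <= j by rewrite lx ltnW.
    have := sorted_drift c'I cs lxj; rewrite c'x cj => /(_ erefl).
    rewrite sx sj lx; case: ifP => iS dr.
      have rx : x < r x by move: dr; rewrite /= /bump; lia.
      by rewrite rx; split => // _; apply: contraTneq rx => ->; rewrite ltnn.
    have nfix : lift j (r x) != lift j x.
      apply: contraTneq xj => e; rewrite -leqNgt -lx; apply: first.
      by rewrite c'x sx e !eqxx.
    have nval : lift j (r x) <> lift j x :> nat by move/val_inj/eqP; apply/negP.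
    have rx : r x < x by move: dr nval; rewrite lx /= /bump; lia.
    by rewrite rx.
  have lx := lift_geE xj.
  have lxj : j < lift j x by rewrite lx ltnS.
  case: ifP => iS.
    have := sorted_permP _ _ cs _ _ lxj; rewrite cj iS c'x => /(_ erefl).
    rewrite sx sj => dr.
    have rx : r x < x by move: dr; rewrite /= /bump; lia.
    rewrite (ltnNge x) (ltnW rx); split => // _.
    by apply: contraTneq rx => ->; rewrite ltnn.
  have := sorted_drift c'I cs (ltnW lxj); rewrite cj iS c'x => /(_ erefl).
  rewrite sx sj lx => dr; split => //.
  by apply/esym/negbTE; move: dr; rewrite /= /bump; lia.
apply/andP; split.
  by apply/implyP => iS; apply/fixfreeP => x; rewrite inE => /eqP /H[_]; apply.
by apply/forall_inP => x /eqP /H[-> _].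
Qed.

(** For the enlarged permutation to be sorted, the values on either side of the
    slot must compare with j itself, not just with their own positions; by
    monotonicity it suffices to check this at the positions next to the slot. *)
Lemma slot_sorted_first_fix j r : c' j = i -> sorted_perm c r ->
  (i \in S) ==> fixfree [set i] c r -> fix_slot c i r j ->
  sorted_perm c' (lift_perm j j r) && first_fix c' i (lift_perm j j r) j.
Proof.
move=> cj cs /implyP ff /forall_inP slot.
have cI : interval_coloring c.
  by move=> x y z xy yz; rewrite -!(cE cj); apply: interval_coloring_lift.
(* In a descending block the position next to the slot is y = j - 1 for x
   before the slot and y = j for x after it; [ff] excludes r y = y. *)
have H x : c x = i ->
    if i \in S then (if x < j then j <= r x else r x < j)
    else (if x < j then r x < j else j <= r x).
  move=> cx; have /eqP := slot x (introT eqP cx).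
  case: ifP => iS; last first.
    case: ltnP => xj /esym; first by move=> rx; apply: ltn_trans xj.
    by move/negbT; rewrite -leqNgt; apply: leq_trans.
  have c'x : c' (lift j x) = i by rewrite cE.
  case: ltnP => xj _.
    have ltj : j.-1 < n by have := ltn_ord j; lia.
    pose y : 'I_n := Ordinal ltj.
    have xy : x <= y by rewrite /=; lia.
    have yj : y < j by rewrite /=; lia.
    have cy : c y = i.
      rewrite -(cE cj) -c'x; apply: (c'I (z := j)); rewrite ?c'x //.
        by rewrite !lift_ltE.
      by rewrite lift_ltE // ltnW.
    have /eqP := slot y (introT eqP cy); rewrite iS yj => /esym ry.
    have := sorted_drift cI cs xy; rewrite cx cy iS => /(_ erefl).
    by move: ry; rewrite /=; lia.
  have ltj : j < n by have := ltn_ord x; lia.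
  pose y : 'I_n := Ordinal ltj.
  have cy : c y = i.
    rewrite -(cE cj) -[RHS]cj; apply: (c'I (z := lift j x)); rewrite ?c'x //.
      by rewrite lift_geE //=.
    by rewrite !lift_geE.
  have /eqP := slot y (introT eqP cy); rewrite iS ltnn => /esym/negbT.
  have := fixfreeP _ _ _ (ff iS) y; rewrite cy inE eqxx => /(_ isT) nfix.
  have {nfix} : r y <> y :> nat by move/val_inj/eqP; apply/negP.
  have := @sorted_drift n c r y x cI cs xj; rewrite cx cy iS => /(_ erefl).
  by rewrite /=; lia.
apply/andP; split.
  apply/sorted_permP => x y; move/sorted_permP in cs.
  case: (unliftP j x) => [x'|] ->; case: (unliftP j y) => [y'|] ->.
  - by rewrite !lift_perm_lift !cE // !ltn_lift; apply: cs.
  - rewrite lift_perm_id lift_perm_lift cE // cj => xj cx.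
    by have := H x' cx; move: xj; rewrite cx lift_ltn ltn_lift_r lift_ltn => ->.
  - rewrite lift_perm_id lift_perm_lift cE // cj => xj /esym cx.
    have := H y' cx; move: xj; rewrite ltn_lift_r lift_ltn ltn_lift_r.
    by rewrite leqNgt => /negPf->.
  by rewrite ltnn.
rewrite /first_fix cj lift_perm_id !eqxx; apply/forall_inP => x.
case: (unliftP j x) => [x'|] -> //.
rewrite lift_perm_lift cE // => /andP[/eqP cx /eqP/lift_inj rx].
rewrite leqNgt; apply/negP => xj.
have := slot x' (introT eqP cx); rewrite rx ltnn.
by move: xj; rewrite lift_ltn => ->; case: ifP.
Qed.

(** The points to be put before the slot form an initial segment of the block,
    by the monotonicity of r(x) - x or r(x) + x; the slot is the least position of the
    enlarged block beyond all of them. *)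
Lemma fix_slot_exists r : (exists j, c' j = i) -> sorted_perm c r ->
  exists2 j, c' j = i & fix_slot c i r j.
Proof.
move=> [j0 c0] cs.
have cI : interval_coloring c.
  by move=> x y z xy yz; rewrite -!(cE c0); apply: interval_coloring_lift.
pose p (x : 'I_n) := if i \in S then x < r x else r x < x.
pose Q (j : 'I_n.+1) := (c' j == i) && [forall x : 'I_n, (c x == i) && p x ==> (x < j)].
have [e ce maxe] : exists2 e : 'I_n.+1, c' e = i & forall y, c' y = i -> y <= e.
  case: (@arg_maxnP _ j0 (fun j => c' j == i) (fun j => j : nat)); first exact/eqP.
  by move=> e /eqP ce H; exists e => // y /eqP; apply: H.
have Qe : Q e.
  rewrite /Q ce eqxx; apply/forall_inP => x /andP[/eqP cx _].
  have := maxe (lift e x); rewrite cE // => /(_ cx).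
  by rewrite /= /bump; case: leqP; lia.
case: (@arg_minnP _ e Q (fun j => j : nat)) => // j /andP[/eqP cj /forall_inP pj] minj.
exists j => //; apply/forall_inP => x /eqP cx; apply/eqP.
rewrite -/(p x); case px: (p x); first by apply: pj; rewrite cx eqxx.
apply/negbTE; rewrite -leqNgt leqNgt; apply/negP => xj.
suff Qx : Q (lift j x) by have := minj _ Qx; rewrite lift_ltE // leqNgt xj.
rewrite /Q cE // cx eqxx; apply/forall_inP => y /andP[/eqP cy py].
rewrite lift_ltE // ltnNge; apply/negP => xy.
have := sorted_drift cI cs xy; rewrite cx cy => /(_ erefl).
by move: px py; rewrite /p; case: ifP; lia.
Qed.

Lemma fix_slot_unique r j k : c' j = i -> c' k = i ->
  fix_slot c i r j -> fix_slot c i r k -> j = k.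
Proof.
wlog jk : j k / j <= k => [H cj ck sj sk|cj ck /forall_inP sj /forall_inP sk].
  by case/orP: (leq_total j k) => ?; [apply: H | apply/esym/H].
apply/val_inj/eqP; rewrite eqn_leq jk leqNgt; apply/negP => ltjk.
have ltj : j < n by have := ltn_ord k; rewrite ltnS; apply: leq_trans.
pose x : 'I_n := Ordinal ltj.
have cx : c x = i.
  rewrite -(cE cj) -[RHS]cj; apply: (c'I (z := k)); rewrite ?cj ?ck //.
    by rewrite lift_geE //=.
  by rewrite lift_geE.
have /eqP := sk x (introT eqP cx); have /eqP <- := sj x (introT eqP cx).
by rewrite /= ltnn ltjk.
Qed.

(** Enlarged permutations with a canonical fixed point correspond to smaller
    permutations with a slot.  The requirement on the fixed points in block i
    survives only in the descending case, where the inserted point is the only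
    fixed point of its block. *)
Lemma sorted_first_fixE P j r : i \notin P -> c' j = i ->
  [&& sorted_perm c' (lift_perm j j r), fixfree P c' (lift_perm j j r)
    & first_fix c' i (lift_perm j j r) j] =
  [&& sorted_perm c r, fixfree (if i \in S then i |: P else P) c r
    & fix_slot c i r j].
Proof.
move=> iP cj; have ffE : fixfree (if i \in S then i |: P else P) c r =
    fixfree P c r && ((i \in S) ==> fixfree [set i] c r).
  case: ifP => _; last by rewrite andbT.
  apply/fixfreeP/andP => [H|[/fixfreeP HP /fixfreeP Hi] x].
    by split; apply/fixfreeP => x cx; apply: H; rewrite !inE in cx *; rewrite cx ?orbT.
  by rewrite inE => /orP[/Hi|/HP].
rewrite fixfree_lift // ffE; apply/and3P/and3P => [[cs fP ff]|[cs /andP[fP fi] sl]].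
  have /andP[fi sl] := sorted_first_fix_slot cj cs ff.
  by split; rewrite ?fP ?(sorted_lift cj).
by have /andP[] := slot_sorted_first_fix cj cs fi sl.
Qed.

Lemma first_fix_count s : \sum_(j | c' j == i) first_fix c' i s j = ~~ fixfree [set i] c' s.
Proof.
case: (boolP (fixfree _ _ _)) => [/fixfreeP H|].
  apply: big1 => j /eqP cj; have := H j; rewrite cj inE eqxx => /(_ isT) sj.
  by rewrite /first_fix (negPf sj) andbF.
rewrite negb_forall_in => /exists_inP[x0]; rewrite inE negbK => cx0 sx0.
case: (@arg_minnP _ x0 (fun x => (c' x == i) && (s x == x)) (fun x => x : nat)).
  by rewrite cx0.
move=> j /andP[cj sj] minj.
have fj : first_fix c' i s j by rewrite /first_fix cj sj; apply/forall_inP.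
rewrite (bigD1 j) //= fj big1 // => k /andP[ck kj].
apply/eqP; rewrite eqb0; apply: contraNN kj => /and3P[_ sk /forall_inP mink].
by apply/eqP/val_inj/eqP; rewrite eqn_leq mink ?cj ?sj // minj // ck sk.
Qed.

Lemma fix_slot_count r : (exists j, c' j = i) -> sorted_perm c r ->
  \sum_(j | c' j == i) fix_slot c i r j = 1.
Proof.
move=> c0 cs; have [j cj sj] := fix_slot_exists c0 cs.
rewrite (bigD1 j) /=; last exact/eqP.
rewrite sj big1 // => k /andP[/eqP ck kj].
by apply/eqP; rewrite eqb0; apply: contraNN kj => sk; apply/eqP/(fix_slot_unique ck cj sk).
Qed.

End Deletion.

Lemma nb_fixfreeE P n (c : 'I_n -> I) :
  nb_fixfree P c = \sum_(s : 'S_n) (sorted_perm c s && fixfree P c s).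
Proof. by rewrite /nb_fixfree -sum1dep_card big_mkcond. Qed.

(** The second summand counts the permutations that do have a fixed point in the
    block of m, through the pairs (smaller permutation, slot); every smaller
    permutation has exactly one slot. *)
Lemma nb_fixfree_step n (c : 'I_n.+1 -> I) m P : interval_coloring c ->
  c m \notin P ->
  nb_fixfree P c = nb_fixfree (c m |: P) c +
    nb_fixfree (if c m \in S then c m |: P else P) (fun x => c (lift m x)).
Proof.
move=> cI; set i := c m => iP; set d := fun x => _.
have dE j : c j = i -> forall x, c (lift j x) = d x.
  by move=> cj x; apply: lift_same_color.
rewrite !nb_fixfreeE (eq_bigr (fun s : 'S_n.+1 =>
    (sorted_perm c s && fixfree (i |: P) c s) +
    \sum_(j | c j == i) [&& sorted_perm c s, fixfree P c s & first_fix c i s j])).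
  rewrite big_split /=; congr (_ + _).
  rewrite exchange_big /=.
  transitivity (\sum_(j | c j == i) \sum_(r : 'S_n)
    [&& sorted_perm d r, fixfree (if i \in S then i |: P else P) d r & fix_slot d i r j]).
    apply: eq_bigr => j /eqP cj.
    under [RHS]eq_bigr => r _ do rewrite -(sorted_first_fixE cI dE) //.
    rewrite -(sum_lift_perm j j (fun s => nat_of_bool
      [&& sorted_perm c s, fixfree P c s & first_fix c i s j])).
    rewrite [RHS]big_mkcond /=; apply: eq_bigr => s _.
    by case: ifP => // sj; rewrite /first_fix sj !andbF.
  rewrite exchange_big /=; apply: eq_bigr => r _.
  case cs: (sorted_perm d r) => /=; last by rewrite big1.
  case: (fixfree _ d r) => /=; last by rewrite big1.
  by rewrite (fix_slot_count cI dE) //; exists m.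
move=> s _; case: (sorted_perm c s) => /=; last by rewrite big1.
case fP: (fixfree P c s) => /=.
  rewrite first_fix_count; case: (boolP (fixfree [set i] c s)) => fi.
    rewrite (_ : fixfree _ _ _) //; apply/fixfreeP => x; rewrite inE.
    by case/orP; [apply: (fixfreeP _ _ _ fi) | apply: (fixfreeP _ _ _ fP)].
  rewrite (_ : fixfree _ _ _ = false) //; apply: contraNF fi => /fixfreeP H.
  by apply/fixfreeP => x cx; apply: H; rewrite inE cx.
rewrite big1 // (_ : fixfree _ _ _ = false) //; apply: contraFF fP => /fixfreeP H.
by apply/fixfreeP => x cx; apply: H; rewrite inE cx orbT.
Qed.

End Blocks.

(** * The common recursion *)

Section Weighted.

Variables (I : finType) (S : {set I}).
Implicit Types (P : {set I}) (i l : I).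

Definition cycle_weight P (T : finType) (c : T -> I) (C : {set T}) : rat :=
  1 - \sum_(i in P)
        (if C \subset [set x | c x == i]
         then if i \in S then - (-1) ^+ #|C| else 1 else 0).

Lemma class_sizeD1 (T : finType) (X : {set T}) (c : T -> I) m l : m \in X ->
  class_size X c l = ((c m == l) + class_size (X :\ m) c l)%N.
Proof.
move=> mX; rewrite /class_size (cardsD1 m) !inE mX; congr (_ + _)%N.
by apply: eq_card => x; rewrite !inE andbA.
Qed.

Lemma sum_class_size (T : finType) (X : {set T}) (c : T -> I) :
  (\sum_l class_size X c l)%N = #|X|.
Proof.
rewrite -sum1_card (partition_big c xpredT) //=; apply: eq_bigr => l _.
by rewrite /class_size -sum1dep_card.
Qed.

Lemma eq_cycle_sum (T : finType) (R : comNzRingType) (w w' : {set T} -> R) X :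
  w =1 w' -> cycle_sum w X = cycle_sum w' X.
Proof. by move=> e; apply: eq_bigr => s _; apply: eq_bigr => C _; apply: e. Qed.

Lemma cycle_sum_free (T : finType) (c : T -> I) X :
  cycle_sum (cycle_weight set0 c) X = (#|X|`!)%:R.
Proof.
rewrite -card_perm -sum1_card natr_sum; apply: eq_big => // s _.
by apply: big1 => C _; rewrite /cycle_weight big_set0 subr0.
Qed.

(** The marking identity with u = -1 from P + i to P for a descending block, and
    with u = 1 from P to P + i for an ascending one. *)
Lemma cycle_sum_step (T : finType) (c : T -> I) X i P : i \notin P ->
  cycle_sum (cycle_weight P c) X =
  cycle_sum (cycle_weight (i |: P) c) X +
  \sum_(m in [set x in X | c x == i])
    cycle_sum (cycle_weight (if i \in S then i |: P else P) c) (X :\ m).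
Proof.
move=> iP; have -> : [set x in X | c x == i] = [set x | c x == i] :&: X.
  by apply/setP => x; rewrite !inE andbC.
case iS: (i \in S).
  rewrite (eq_cycle_sum (w' := fun C => cycle_weight (i |: P) c C -
     (if C \subset [set x | c x == i] then (-1) ^+ #|C| else 0))); last first.
    move=> C; rewrite /cycle_weight big_setU1 //= iS.
    by case: ifP => _; ring.
  by rewrite cycle_sum_marking mulN1r opprK.
rewrite [X in _ = X + _](eq_cycle_sum (w' := fun C => cycle_weight P c C -
     (if C \subset [set x | c x == i] then 1 ^+ #|C| else 0))); last first.
  move=> C; rewrite /cycle_weight big_setU1 //= iS.
  by case: ifP => _; rewrite ?expr1n; ring.
by rewrite cycle_sum_marking mul1r subrK.
Qed.

Lemma nb_fixfree_empty P i n (c : 'I_n -> I) : (forall x, c x != i) ->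
  nb_fixfree S (i |: P) c = nb_fixfree S P c.
Proof.
move=> ci; apply: eq_card => s; rewrite !inE; congr (_ && _).
by apply: eq_forallb => x; rewrite !inE (negPf (ci x)).
Qed.

(** Induction on P, and for given P on n: in the descending case the smaller
    permutations still carry the constraint on block i.  The two sides live on
    unrelated sets with the same block sizes because the position deleted on the
    left is fixed while the point removed on the right ranges over the block. *)
Lemma nb_fixfree_cycle_sum P n (c : 'I_n -> I) (T : finType) (cT : T -> I) X :
  interval_coloring c -> (forall l, class_size setT c l = class_size X cT l) ->
  (nb_fixfree S P c * class_fact c)%:R = cycle_sum (cycle_weight P cT) X.
Proof.
have [k] := ubnP #|P|; elim: k P n c T cT X => // k IHk P n c T cT X.
have [-> _ _ eq_size|[i iP]] := set_0Vmem P.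
  rewrite nb_sorted cycle_sum_free -(sum_class_size X cT).
  by rewrite -(eq_bigr _ (fun l _ => eq_size l)) sum_class_size cardsT card_ord.
rewrite -(setD1K iP); set P' := P :\ i.
have iP' : i \notin P' by rewrite !inE eqxx.
rewrite cardsU1 iP' add1n ltnS => ltP'k.
(* with block i empty, imposing the constraint on it changes neither side *)
have empty_block m (d : 'I_m -> I) (U : finType) (dU : U -> I) Y :
    interval_coloring d -> (forall l, class_size setT d l = class_size Y dU l) ->
    (forall x, d x != i) ->
    (nb_fixfree S (i |: P') d * class_fact d)%:R =
    cycle_sum (cycle_weight (i |: P') dU) Y.
  move=> dI eq_size di.
  rewrite nb_fixfree_empty // (IHk _ _ _ _ _ _ ltP'k dI eq_size).
  rewrite (cycle_sum_step _ _ iP') big_pred0 ?addr0 // => x.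
  apply/negbTE/negP => xY; have := eq_size i.
  rewrite /class_size [RHS](cardsD1 x) xY (_ : [set _ in _ | _] = set0) ?cards0 //.
  by apply/setP => y; rewrite !inE; apply/negbTE/di.
elim: n c T cT X => [|n IHn] c T cT X cI eq_size.
  by apply: empty_block => //; case.
have [|/exists_inPn ci] := boolP [exists m in [set: 'I_n.+1], c m == i]; last first.
  by apply: empty_block => // x; apply: ci.
case/exists_inP=> m0 _ /eqP cm0.
apply: (addIr (\sum_(m in [set x in X | cT x == i])
    cycle_sum (cycle_weight (if i \in S then i |: P' else P') cT) (X :\ m))).
rewrite -cycle_sum_step // -(IHk _ _ _ _ _ _ ltP'k cI eq_size).
rewrite [in RHS](@nb_fixfree_step _ _ _ _ m0 P' cI) ?cm0 // mulnDl natrD; congr (_ + _).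
rewrite [class_fact c](class_fact_lift c m0) cm0 mulnCA natrM.
rewrite [class_size _ _ _]eq_size mulr_natl -sumr_const.
apply: eq_bigr => m; rewrite inE => /andP[mX /eqP cm].
have dI := @interval_coloring_lift _ _ _ m0 cI.
have size' l : class_size setT (fun x => c (lift m0 x)) l = class_size (X :\ m) cT l.
  apply: (@addnI (c m0 == l)); rewrite -class_size_lift cm0 -cm.
  by rewrite -class_sizeD1 ?eq_size.
by case: ifP => _; [rewrite (IHn _ _ cT (X :\ m))|rewrite (IHk _ _ _ _ cT (X :\ m))].
Qed.

End Weighted.

(** * Consecutive blocks *)

Section BlockColoring.
Local Open Scope nat_scope.

Variables (k : nat) (hk : 0 < k) (a : 'I_k -> nat) (S : {set 'I_k}).
Let N := block_total a.

Lemma block_le (i i' : 'I_k) (x y : 'I_N) :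
  x \in block a i -> y \in block a i' -> x <= y -> i <= i'.
Proof.
rewrite !inE => /andP[ix _] /andP[_ yi'] xy; rewrite leqNgt; apply/negP => i'i.
have: \sum_(l < k | l <= i') a l <= \sum_(l < k | l < i) a l.
  rewrite [leqLHS]big_mkcond [leqRHS]big_mkcond; apply: leq_sum => l _.
  by case: ifP => // li'; rewrite (leq_ltn_trans li' i'i).
by move=> /(leq_trans yi'); rewrite ltnNge (leq_trans ix xy).
Qed.

Lemma block_uniq (i i' : 'I_k) (x : 'I_N) :
  x \in block a i -> x \in block a i' -> i = i'.
Proof.
by move=> xi xi'; apply/val_inj/eqP; rewrite eqn_leq !(block_le _ _ (leqnn x)).
Qed.

(** The block of x is the first one whose right end exceeds x. *)
Lemma block_ex (x : 'I_N) : exists i, x \in block a i.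
Proof.
have ltk : k.-1 < k by rewrite prednK.
pose Q (i : 'I_k) := x < \sum_(l < k | l <= i) a l.
have Qe : Q (Ordinal ltk).
  rewrite /Q (eq_bigl xpredT) ?ltn_ord // => l /=.
  by have := ltn_ord l; lia.
case: (@arg_minnP _ _ Q (fun i => i : nat) Qe) => i Qi mini.
exists i; rewrite inE; apply/andP; split; last exact: Qi.
rewrite leqNgt; apply/negP => xi.
case: i => -[|i] ltik in Qi mini xi *; first by rewrite big_pred0 in xi.
by have := mini (Ordinal (ltnW ltik)) xi; rewrite /= ltnn.
Qed.

Definition block_color (x : 'I_N) : 'I_k :=
  odflt (Ordinal hk) [pick i | x \in block a i].

Lemma in_block i x : (x \in block a i) = (block_color x == i).
Proof.
have xc : x \in block a (block_color x).
  rewrite /block_color; case: pickP => //= no; have [j xj] := block_ex x.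
  by rewrite no in xj.
by apply/idP/eqP => [xi|<- //]; apply: block_uniq xc xi.
Qed.

Lemma block_color_interval : interval_coloring block_color.
Proof.
move=> x y z xy yz cxz.
have inb u : u \in block a (block_color u) by rewrite in_block.
apply/val_inj/eqP; rewrite eqn_leq (block_le (inb x) (inb y)) // andbT.
by rewrite cxz (block_le (inb y) (inb z)).
Qed.

Lemma block_color_class_size i : class_size setT block_color i = a i.
Proof.
rewrite /class_size (_ : [set _ in _ | _] = block a i); last first.
  by apply/setP => x; rewrite in_block !inE.
have split_le : \sum_(l < k | l <= i) a l = \sum_(l < k | l < i) a l + a i.
  rewrite (bigD1 i) //= addnC; congr (_ + _); apply: eq_bigl => l.
  by rewrite ltn_neqAle andbC.
set s := \sum_(l < k | l < i) a l in split_le *.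
have leN : s + a i <= N.
  by rewrite -split_le /N /block_total [leqLHS]big_mkcond; apply: leq_sum => l _; case: ifP.
rewrite /block split_le -sum1dep_card.
rewrite -(big_ord_widen_cond _ (fun j => s <= j) (fun=> 1) leN) big_split_ord /=.
rewrite big_pred0 => [|j]; last by rewrite leqNgt ltn_ord.
by rewrite add0n (eq_bigl xpredT) ?sum1_card ?card_ord // => j; rewrite leq_addr.
Qed.

(** Monotonicity between adjacent positions propagates along a block. *)
Lemma is_block_permE s : is_block_perm S s = sorted_perm S block_color s.
Proof.
apply/forallP/sorted_permP => [H x y|H i]; last first.
  apply/forall_inP => x; rewrite in_block => /eqP cx.
  apply/forall_inP => y; rewrite in_block => /eqP cy.
  by apply/implyP => /eqP yx; have := H x y; rewrite yx cx cy; apply.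
case: y => y; elim: y => // y IHy yN; rewrite ltnS leq_eqVlt => xy cxy.
pose z : 'I_N := Ordinal (ltnW yN).
have cz : block_color z = block_color x.
  apply: (block_color_interval (z := Ordinal yN)) => //=.
  by case/predU1P: xy => [->|/ltnW].
have := forall_inP (H (block_color x)) z; rewrite in_block cz eqxx => /(_ isT).
move/forall_inP/(_ (Ordinal yN)); rewrite in_block -cxy !eqxx => /(_ isT) /= zy.
have [xz|xy'] := predU1P xy; first by rewrite (_ : x = z) ?cz //; apply: val_inj.
have := IHy (ltnW yN) xy' (esym cz); rewrite -/z; move: zy.
by case: ifP => _ yz zx; [apply: ltn_trans yz zx | apply: ltn_trans zx yz].
Qed.

Lemma is_block_derangementE s :
  is_block_derangement S s =
  sorted_perm S block_color s && fixfree setT block_color s.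
Proof.
rewrite /is_block_derangement is_block_permE; congr (_ && _).
by apply: eq_forallb => x; rewrite inE.
Qed.

End BlockColoring.

Lemma cycle_weight_block k (hk : (0 < k)%N) (a : 'I_k -> nat) (S : {set 'I_k})
    (s : 'S_(block_total a)) C : C \in porbits s ->
  cycle_weight S setT (block_color hk (a := a)) C =
  if [exists i, C \subset block a i] then
    if odd #|C| || [exists i, (i \notin S) && (C \subset block a i)] then 0 else 2%:R
  else 1.
Proof.
case/porbits_ex=> x Cx.
have classE i : [set y | block_color hk (a := a) y == i] = block a i.
  by apply/setP => y; rewrite inE in_block.
rewrite /cycle_weight; under eq_bigr => i _ do rewrite classE.
case: existsP => [[i Ci]|nC]; last first.
  rewrite big1 ?subr0 // => i _; case: ifP => // Ci.
  by case: nC; exists i.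
have uniqi j : C \subset block a j -> j = i.
  move=> Cj; have xC : x \in C by rewrite Cx porbit_id.
  exact: block_uniq (subsetP Cj x xC) (subsetP Ci x xC).
rewrite (bigD1 i) ?inE //= Ci big1 ?addr0; last first.
  by move=> j; case: ifP => // /uniqi->; rewrite eqxx andbF.
have -> : [exists j, (j \notin S) && (C \subset block a j)] = (i \notin S).
  apply/existsP/idP => [[j /andP[jS /uniqi <-]] //|iS]; by exists i; rewrite iS.
case: (i \in S) => /=; last by rewrite orbT subrr.
by rewrite orbF -signr_odd opprK; case: odd; rewrite ?expr1 ?subrr.
Qed.

Lemma cS_prod k (hk : (0 < k)%N) (a : 'I_k -> nat) (S : {set 'I_k})
    (s : 'S_(block_total a)) :
  (cS S s)%:R = \prod_(C in porbits s) cycle_weight S setT (block_color hk (a := a)) C.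
Proof.
rewrite (eq_bigr _ (fun C Cs => cycle_weight_block hk S Cs)) /cS.
case: ifPn => [/exists_inP[C]|/exists_inPn no_bad].
  by rewrite inE => /andP[Cs small] bad; rewrite (bigD1 C) //= small bad mul0r.
rewrite -big_mkcondr /= (eq_bigr (fun=> 2%:R)) => [|C /andP[Cs small]]; last first.
  by rewrite (negPf (no_bad C _)) // inE Cs.
by rewrite prodr_const natrX; congr (_ ^+ _); apply: eq_card => C; rewrite !inE.
Qed.

Theorem theorem5p1 (k : nat) (hk : (1 <= k)%N) (a : 'I_k -> nat)
    (S : {set 'I_k}) :
  #|[set s : 'S_(block_total a) | is_block_derangement S s]|%:R =
    (\prod_(i < k) (a i)`!)%N%:R^-1 * \sum_(s : 'S_(block_total a)) (cS S s)%:R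
  :> rat.
Proof.
have factE : class_fact (block_color hk (a := a)) = (\prod_(i < k) (a i)`!)%N.
  by apply: eq_bigr => i _; rewrite block_color_class_size.
rewrite -factE; set f := class_fact _.
have f_neq0 : f%:R != 0 :> rat.
  by rewrite Num.Theory.pnatr_eq0 -lt0n prodn_gt0 // => i; apply: fact_gt0.
apply: (mulfI f_neq0); rewrite mulVKf // -natrM mulnC.
rewrite (eq_card (B := [set s | sorted_perm S (block_color hk (a := a)) s
                  && fixfree setT (block_color hk (a := a)) s])); last first.
  by move=> s; rewrite !inE (is_block_derangementE hk S).
rewrite (@nb_fixfree_cycle_sum _ S setT _ _ _ (block_color hk (a := a)) setT
  (@block_color_interval k hk a)) //.
apply: eq_big => [s|s _]; first by apply/subsetP => x; rewrite inE.
by rewrite (cS_prod hk); apply: eq_bigl => C; rewrite subsetT andbT.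
Qed.
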